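(* For every $i\in\mathbb Z$ and every $z=([\phi],[\vartheta],\omega,v)\in\mathcal I^+$, the iterates of $\mathrm T^2$ are given by $$\mathrm T^{2i}(z)=\big(\phi+i\,\varphi(z),\ \vartheta,\ \omega,\ v\big),$$ where $\varphi:\mathcal I^+\to\mathbb S^1$ denotes the continuous $SO(2)$-invariant function defined by $\varphi(z)=\Omega(z)+\Omega(\mathrm T(z))$.
   Context: Let $R,\ell,m,J>0$, $\mathbb S^1=\mathbb R/2\pi\mathbb Z$, $\mathbb T^2=\mathbb S^1\times\mathbb S^1$. These data describe a knife-edge (segment of length $2\ell$, mass $m$, moment of inertia $J$) moving in a disk of radius $R$ centered at the origin. **Impact states.** Write $z=([\phi],[\vartheta],\omega,v)\in\mathbb T^2\times(\mathbb R^2\setminus\{(0,0)\})$. Set $\mathcal I_f=\{z:\ \ell/R<\cos\vartheta\}$ (front-type), $\mathcal I_b=\{z:\ \ell/R<-\cos\vartheta\}$ (back-type), $\mathcal I=\mathcal I_f\cup\mathcal I_b$. The midpoint represented by $z$ is $p(z)=R(\cos\phi,\sin\phi)\mp\ell(\cos(\phi-\vartheta),\sin(\phi-\vartheta))$ with $-$ for front-type and $+$ for back-type. Put $N(z)=\ell\omega\sin\vartheta+v\cos\vartheta$ for $z\in\mathcal I_f$ and $N(z)=v\cos\vartheta-\ell\omega\sin\vartheta$ for $z\in\mathcal I_b$. Set $\mathcal{RI}^-=\{N>0\}$, $\mathcal{RI}^+=\{N<0\}$, $\mathcal{TI}=\{N=0\}$ (subsets of $\mathcal I$), $\mathcal I^\pm=\mathcal{RI}^\pm\cup\mathcal{TI}$,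 $\mathcal I_f^-=\mathcal I^-\cap\mathcal I_f$, $\mathcal I_b^-=\mathcal I^-\cap\mathcal I_b$. **Coupled circle map.** Let $\mathcal{RI}_v^+=\{z\in\mathcal{RI}^+:\omega=0\}$. For $z\in\mathcal I^+\setminus\mathcal{RI}^+_v$ (where $\omega\ne0$) let $\mathrm c(z)=p(z)+\frac v\omega(-\sin(\phi-\vartheta),\cos(\phi-\vartheta))$, $d=\|\mathrm c(z)\|$, $r=\sqrt{(v/\omega)^2+\ell^2}$, $\alpha=\arccos\frac{d^2+R^2-r^2}{2dR}$. Define $\Omega:\mathcal I^+\to\mathbb S^1$ by $\Omega(z)=[-2\,\mathrm{sgn}(\omega)\alpha(z)]$ if $z\notin\mathcal{RI}_v^+$ and $\Omega(z)=[-2\vartheta+\pi]$ if $z\in\mathcal{RI}_v^+$. Then $\mathrm{Ro}:\mathcal I^+\to\mathcal I^-$, $\mathrm{Ro}(z)=([\phi]+\Omega(z),[-\vartheta+\pi],\omega,v)$. **Impact map.** With $\mathrm D(\vartheta)=\frac{\ell^2}{J}\sin^2\vartheta+\frac1m\cos^2\vartheta$, let $\mathrm I:\mathcal I^-\to\mathcal I^+$, $\mathrm I(z)=(\phi,\vartheta,\mathcal R_f^\vartheta(\omega,v))$ if $z\in\mathcal I_f^-$ and $\mathrm I(z)=(\phi,\vartheta,\mathcal R_b^\vartheta(\omega,v))$ if $z\in\mathcal I_b^-$, where (row vector times matrix) $$\mathcal R_{f}^\vartheta(\omega,v)=(\omega,v)\begin{pmatrix}1-\frac{2\ell^2\sin^2\vartheta}{J\mathrm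 D(\vartheta)}&-\frac{2\ell\cos\vartheta\sin\vartheta}{m\mathrm D(\vartheta)}\\-\frac{2\ell\cos\vartheta\sin\vartheta}{J\mathrm D(\vartheta)}&1-\frac{2\cos^2\vartheta}{m\mathrm D(\vartheta)}\end{pmatrix},$$ and $\mathcal R_b^\vartheta$ is given by the same matrix with both off-diagonal entries replaced by their negatives. Set $\mathrm T=\mathrm I\circ\mathrm{Ro}:\mathcal I^+\to\mathcal I^+$; negative powers are iterates of the inverse map. A function on $\mathcal I^+$ is $SO(2)$-invariant if it is unchanged under $([\phi],[\vartheta],\omega,v)\mapsto([\phi]+\tau,[\vartheta],\omega,v)$ for every $\tau\in\mathbb S^1$, i.e. independent of $\phi$. *)

(* Defs.v *)
From HB Require Import structures.
From mathcomp Require Import all_boot all_order all_algebra.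
From mathcomp Require Import ring_quotient.
From mathcomp Require Import all_classical all_reals all_analysis.
From mathcomp Require Import ring lra.

Set Implicit Arguments.
Unset Strict Implicit.
Unset Printing Implicit Defensive.

Import Order.TTheory GRing.Theory Num.Theory.
Import numFieldNormedType.Exports.

Local Open Scope classical_set_scope.
Local Open Scope ring_scope.
Local Open Scope quotient_scope.

Definition twopiZ (K : realType) : {pred K} :=
  fun x => `[< exists k : int, x = pi *+ 2 *~ k >].
Arguments twopiZ : clear implicits.

Lemma twopiZ_zmod_closed (K : realType) : zmod_closed (twopiZ K).
Proof.
split=> [|x y].
  by apply/asboolP; exists 0; rewrite mulr0z.
move=> /asboolP[k ->] /asboolP[l ->]; apply/asboolP.
by exists (k - l); rewrite mulrzBr.
Qed.

HB.instance Definition _ (K : realType) :=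
  GRing.isZmodClosed.Build K (twopiZ K) (twopiZ_zmod_closed K).

Definition circle (K : realType) : Type :=
  quotient_topology (Quotient.quot (twopiZ K)).

HB.instance Definition _ (K : realType) := Topological.on (circle K).
HB.instance Definition _ (K : realType) := GRing.isZmodule.Build (circle K)
  (@Quotient.addqA _ (twopiZ K)) (@Quotient.addqC _ (twopiZ K))
  (@Quotient.add0q _ (twopiZ K)) (@Quotient.addNq _ (twopiZ K)).

Definition circ (K : realType) (a : K) : circle K :=
  \pi_(Quotient.quot (twopiZ K)) a.

(* Cosine and sine on the circle, independent of the representative by
   [ccosE] and [csinE] below. *)
Definition ccos (K : realType) (x : circle K) : K :=
  cos (repr (x : Quotient.quot (twopiZ K))).
Definition csin (K : realType) (x : circle K) : K :=
  sin (repr (x : Quotient.quot (twopiZ K))).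

Section circle_theory.
Variable K : realType.
Implicit Types (x y : circle K) (a b : K).

Lemma circ_repr x : exists a, x = circ a.
Proof. by exists (repr (x : Quotient.quot (twopiZ K))); rewrite /circ reprK. Qed.

Lemma circE a b : circ a = circ b <-> exists k : int, a = b + pi *+ 2 *~ k.
Proof.
have h : (a - b \in twopiZ K) = (a == b %[mod Quotient.quot (twopiZ K)]).
  exact: Quotient.idealrBE.
split=> [ab|[k ->]].
  have /asboolP[k abk] : a - b \in twopiZ K by rewrite h; apply/eqP.
  by exists k; rewrite -abk addrC subrK.
apply/(@eqP (Quotient.quot (twopiZ K))).
rewrite -Quotient.idealrBE addrAC subrr add0r.
by apply/asboolP; exists k.
Qed.

Lemma circD a b : circ (a + b) = circ a + circ b.
Proof. exact: (@Quotient.pi_add _ (twopiZ K) a b). Qed.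

Lemma circN a : circ (- a) = - circ a.
Proof. exact: (@Quotient.pi_opp _ (twopiZ K) a). Qed.

Lemma ccosE a : ccos (circ a) = cos a.
Proof.
rewrite /ccos; have /circE[[k|k] ->] :
    circ (repr (circ a : Quotient.quot (twopiZ K))) = circ a.
- by rewrite /circ reprK.
- by rewrite -pmulrn (periodicn (@cosD2pi K)).
- by rewrite NegzE mulrNz -[RHS](congr1 _ (subrK (pi *+ 2 *+ k.+1) a))
    (periodicn (@cosD2pi K)).
Qed.

Lemma csinE a : csin (circ a) = sin a.
Proof.
rewrite /csin; have /circE[[k|k] ->] :
    circ (repr (circ a : Quotient.quot (twopiZ K))) = circ a.
- by rewrite /circ reprK.
- by rewrite -pmulrn (periodicn (@sinD2pi K)).
- by rewrite NegzE mulrNz -[RHS](congr1 _ (subrK (pi *+ 2 *+ k.+1) a))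
    (periodicn (@sinD2pi K)).
Qed.

Lemma ccos_flip x : ccos (- x + circ pi) = - ccos x.
Proof.
by have [a ->] := circ_repr x; rewrite -circN -circD !ccosE cosDpi cosN.
Qed.

Lemma csin_flip x : csin (- x + circ pi) = csin x.
Proof.
by have [a ->] := circ_repr x;
  rewrite -circN -circD !csinE sinDpi sinN opprK.
Qed.

End circle_theory.

(* [(([phi], [theta]), (omega, v))]; the condition [(omega, v) <> (0, 0)] is
   part of [front] and [back] below. *)
Definition state (K : realType) : Type :=
  ((circle K * circle K) * (K * K))%type.

HB.instance Definition _ (K : realType) := Topological.on (state K).

Notation phi_ z := z.1.1.
Notation theta_ z := z.1.2.
Notation omega_ z := z.2.1.
Notation v_ z := z.2.2.

Section impact_states.
Variables (K : realType) (R ell : {posnum K}).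
Implicit Type z : state K.

Definition front : set (state K) :=
  [set z | z.2 <> (0, 0) /\ ell%:num / R%:num < ccos (theta_ z)].

Definition back : set (state K) :=
  [set z | z.2 <> (0, 0) /\ ell%:num / R%:num < - ccos (theta_ z)].

Definition impact : set (state K) := front `|` back.

(* On [impact], which is the disjoint union of [front] and [back], the second
   branch of each [if z \in front] is the back-type case. *)
Definition midpoint z : K * K :=
  let e := (ccos (phi_ z - theta_ z), csin (phi_ z - theta_ z)) in
  let q := (R%:num * ccos (phi_ z), R%:num * csin (phi_ z)) in
  if z \in front then (q.1 - ell%:num * e.1, q.2 - ell%:num * e.2)
  else (q.1 + ell%:num * e.1, q.2 + ell%:num * e.2).

Definition normal_velocity z : K :=
  if z \in front then
    ell%:num * omega_ z * csin (theta_ z) + v_ z * ccos (theta_ z)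
  else v_ z * ccos (theta_ z) - ell%:num * omega_ z * csin (theta_ z).

Definition RIminus : set (state K) := impact `&` [set z | 0 < normal_velocity z].
Definition RIplus : set (state K) := impact `&` [set z | normal_velocity z < 0].
Definition TI : set (state K) := impact `&` [set z | normal_velocity z = 0].

Definition Iminus : set (state K) := RIminus `|` TI.
Definition Iplus : set (state K) := RIplus `|` TI.

Definition Iminus_f : set (state K) := Iminus `&` front.

Lemma IminusP z : Iminus z <-> impact z /\ 0 <= normal_velocity z.
Proof.
split=> [[] [iz /= h]|[iz]]; first by split=> //; rewrite ltW.
  by split=> //; rewrite h.
by rewrite le_eqVlt => /orP[/eqP h|h]; [right|left]; split=> //=.
Qed.

Lemma IplusP z : Iplus z <-> impact z /\ normal_velocity z <= 0.
Proof.
split=> [[] [iz /= h]|[iz]]; first by split=> //; rewrite ltW.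
  by split=> //; rewrite h.
by rewrite le_eqVlt => /orP[/eqP h|h]; [right|left]; split=> //=.
Qed.

Lemma front_back z : front z -> back z -> False.
Proof.
move=> [_ h1] [_ h2]; have : 0 < ell%:num / R%:num by [].
by move: h1 h2; set c := ccos _; set d := _ / _; lra.
Qed.

Lemma front_in z : front z -> (z \in front) = true.
Proof. by move=> fz; rewrite mem_set. Qed.

Lemma back_in z : back z -> (z \in front) = false.
Proof. by move=> bz; apply/negP => /set_mem fz; apply: (front_back fz bz). Qed.

Definition RIv_plus : set (state K) := RIplus `&` [set z | omega_ z = 0].

(* [center], [path_radius] and [alpha] are only used for [omega_ z <> 0]. *)
Definition center z : K * K :=
  let p := midpoint z in
  (p.1 + v_ z / omega_ z * - csin (phi_ z - theta_ z),
   p.2 + v_ z / omega_ z * ccos (phi_ z - theta_ z)).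

Definition center_dist z : K :=
  Num.sqrt ((center z).1 ^+ 2 + (center z).2 ^+ 2).

Definition path_radius z : K :=
  Num.sqrt ((v_ z / omega_ z) ^+ 2 + ell%:num ^+ 2).

Definition alpha z : K :=
  acos ((center_dist z ^+ 2 + R%:num ^+ 2 - path_radius z ^+ 2)
        / (2 * center_dist z * R%:num)).

Definition Omega (z : Iplus) : circle K :=
  let u := val z in
  if u \in RIv_plus then - (theta_ u *+ 2) + circ pi
  else circ (- 2 * Num.sg (omega_ u) * alpha u).

Definition Ro_state (z : Iplus) : state K :=
  let u := val z in
  ((phi_ u + Omega z, - theta_ u + circ pi), u.2).

Lemma front_Ro (z : Iplus) : back (val z) -> front (Ro_state z).
Proof. by move=> [h0 h]; split=> //=; rewrite ccos_flip. Qed.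

Lemma back_Ro (z : Iplus) : front (val z) -> back (Ro_state z).
Proof. by move=> [h0 h]; split=> //=; rewrite ccos_flip opprK. Qed.

Lemma Ro_subproof (z : Iplus) : Ro_state z \in Iminus.
Proof.
have /set_mem/IplusP[iz nz] := valP z.
apply/mem_set/IminusP; case: iz => [fz|bz].
- have bz := back_Ro fz; split; first by right.
  move: nz; rewrite /= /normal_velocity (front_in fz) (back_in bz) /=.
  by rewrite ccos_flip csin_flip; lra.
- have fz := front_Ro bz; split; first by left.
  move: nz; rewrite /= /normal_velocity (front_in fz) (back_in bz) /=.
  by rewrite ccos_flip csin_flip; lra.
Qed.

Definition Ro (z : Iplus) : Iminus := exist _ (Ro_state z) (Ro_subproof z).

End impact_states.

Definition mx22 (K : realType) (a b c d : K) : 'M[K]_2 :=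
  \matrix_(i < 2, j < 2) nth 0 (nth [::] [:: [:: a; b]; [:: c; d]] i) j.

Definition vec_mx22 (K : realType) (x : K * K) (A : 'M[K]_2) : K * K :=
  (x.1 * A 0 0 + x.2 * A 1 0, x.1 * A 0 1 + x.2 * A 1 1).

Section impact_map.
Variables (K : realType) (R ell m J : {posnum K}).
Implicit Types (th : circle K) (z : state K).

Definition Dcoef th : K :=
  ell%:num ^+ 2 / J%:num * csin th ^+ 2 + (m%:num)^-1 * ccos th ^+ 2.

Definition refl_f_mx th : 'M[K]_2 := mx22
  (1 - 2 * ell%:num ^+ 2 * csin th ^+ 2 / (J%:num * Dcoef th))
  (- (2 * ell%:num * ccos th * csin th / (m%:num * Dcoef th)))
  (- (2 * ell%:num * ccos th * csin th / (J%:num * Dcoef th)))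
  (1 - 2 * ccos th ^+ 2 / (m%:num * Dcoef th)).

Definition refl_b_mx th : 'M[K]_2 := mx22
  (1 - 2 * ell%:num ^+ 2 * csin th ^+ 2 / (J%:num * Dcoef th))
  (2 * ell%:num * ccos th * csin th / (m%:num * Dcoef th))
  (2 * ell%:num * ccos th * csin th / (J%:num * Dcoef th))
  (1 - 2 * ccos th ^+ 2 / (m%:num * Dcoef th)).

Definition refl_f th (x : K * K) : K * K := vec_mx22 x (refl_f_mx th).
Definition refl_b th (x : K * K) : K * K := vec_mx22 x (refl_b_mx th).

(* The second branch is the case [val z \in Iminus `&` back]. *)
Definition Imp_state (z : Iminus R ell) : state K :=
  let u := val z in
  if u \in Iminus_f R ell then (u.1, refl_f (theta_ u) u.2)
  else (u.1, refl_b (theta_ u) u.2).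

Lemma csc2 th : csin th ^+ 2 + ccos th ^+ 2 = 1.
Proof. by have [a ->] := circ_repr th; rewrite csinE ccosE addrC cos2Dsin2. Qed.

Lemma Dcoef_gt0 th : 0 < Dcoef th.
Proof.
have h := csc2 th.
have hJ : 0 < ell%:num ^+ 2 / J%:num by [].
have hm : 0 < (m%:num)^-1 by [].
rewrite /Dcoef; have [s0|sn0] := eqVneq (csin th) 0.
  move: h; rewrite s0 expr0n /= add0r mulr0 add0r => ->.
  by rewrite mulr1.
apply: ltr_wpDr; first by rewrite mulr_ge0 ?sqr_ge0// ltW.
by rewrite mulr_gt0// exprn_even_gt0.
Qed.

Lemma refl_fE th w v : refl_f th (w, v) =
  (w - 2 * (ell%:num * w * csin th + v * ccos th) * ell%:num * csin th
       / (J%:num * Dcoef th),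
   v - 2 * (ell%:num * w * csin th + v * ccos th) * ccos th
       / (m%:num * Dcoef th)).
Proof.
have D0 : Dcoef th != 0 by rewrite gt_eqF// Dcoef_gt0.
have J0 : J%:num != 0 by [].
have m0 : m%:num != 0 by [].
by rewrite /refl_f /vec_mx22 !mxE /=; congr (_, _); field; rewrite D0 ?J0 ?m0.
Qed.

Lemma refl_bE th w v : refl_b th (w, v) =
  (w + 2 * (v * ccos th - ell%:num * w * csin th) * ell%:num * csin th
       / (J%:num * Dcoef th),
   v - 2 * (v * ccos th - ell%:num * w * csin th) * ccos th
       / (m%:num * Dcoef th)).
Proof.
have D0 : Dcoef th != 0 by rewrite gt_eqF// Dcoef_gt0.
have J0 : J%:num != 0 by [].
have m0 : m%:num != 0 by [].
by rewrite /refl_b /vec_mx22 !mxE /=; congr (_, _); field; rewrite D0 ?J0 ?m0.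
Qed.

Lemma refl_f_normal th w v (x := refl_f th (w, v)) :
  ell%:num * x.1 * csin th + x.2 * ccos th
  = - (ell%:num * w * csin th + v * ccos th).
Proof.
have D0 : Dcoef th != 0 by rewrite gt_eqF// Dcoef_gt0.
have J0 : J%:num != 0 by [].
have m0 : m%:num != 0 by [].
rewrite /x refl_fE /=; set N := _ + v * _.
transitivity (N - 2 * N * (Dcoef th / Dcoef th)); last by rewrite divff//; ring.
by rewrite [X in _ * (X / _)]/Dcoef /N; field; rewrite D0 ?J0 ?m0.
Qed.

Lemma refl_b_normal th w v (x := refl_b th (w, v)) :
  x.2 * ccos th - ell%:num * x.1 * csin th
  = - (v * ccos th - ell%:num * w * csin th).
Proof.
have D0 : Dcoef th != 0 by rewrite gt_eqF// Dcoef_gt0.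
have J0 : J%:num != 0 by [].
have m0 : m%:num != 0 by [].
rewrite /x refl_bE /=; set N := v * _ - _ * w * _.
transitivity (N - 2 * N * (Dcoef th / Dcoef th)); last by rewrite divff//; ring.
by rewrite [X in _ * (X / _)]/Dcoef /N; field; rewrite D0 ?J0 ?m0.
Qed.

Lemma refl_f_neq0 th w v : (w, v) <> (0, 0) -> refl_f th (w, v) <> (0, 0).
Proof.
move=> wv0 h; have := refl_f_normal th w v; rewrite h /=.
rewrite mulr0 mul0r mul0r addr0 => /esym/eqP; rewrite oppr_eq0 => /eqP N0.
by move: h; rewrite refl_fE N0 !(mulr0, mul0r) !subr0.
Qed.

Lemma refl_b_neq0 th w v : (w, v) <> (0, 0) -> refl_b th (w, v) <> (0, 0).
Proof.
move=> wv0 h; have := refl_b_normal th w v; rewrite h /=.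
rewrite mulr0 !mul0r subr0 => /esym/eqP; rewrite oppr_eq0 => /eqP N0.
by move: h; rewrite refl_bE N0 !(mulr0, mul0r) subr0 addr0.
Qed.

Lemma Imp_subproof (z : Iminus R ell) : Imp_state z \in Iplus R ell.
Proof.
have /set_mem Iz := valP z; have /IminusP[iz nz] := Iz.
apply/mem_set/IplusP; rewrite /Imp_state.
move: iz nz Iz; case: (val z) => -[ph th] [w v] iz nz Iz /=.
case: iz => [fz|bz].
- rewrite (mem_set (conj Iz fz : Iminus_f R ell _)).
  have fz' : front R ell ((ph, th), refl_f th (w, v)).
    by case: fz => h0 h; split=> //=; exact: refl_f_neq0.
  split; first by left.
  move: nz; rewrite /normal_velocity (front_in fz) (front_in fz') /=.
  by rewrite refl_f_normal oppr_le0.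
- have -> : ((ph, th, (w, v)) \in Iminus_f R ell) = false.
    by apply/negP => /set_mem[_ fz]; exact: front_back fz bz.
  have bz' : back R ell ((ph, th), refl_b th (w, v)).
    by case: bz => h0 h; split=> //=; exact: refl_b_neq0.
  split; first by right.
  move: nz; rewrite /normal_velocity (back_in bz) (back_in bz') /=.
  by rewrite refl_b_normal oppr_le0.
Qed.

Definition Imp (z : Iminus R ell) : Iplus R ell :=
  exist _ (Imp_state z) (Imp_subproof z).

Definition T (z : Iplus R ell) : Iplus R ell := Imp (Ro z).

Definition drift (z : Iplus R ell) : circle K := Omega z + Omega (T z).

Definition SO2_invariant (X : Type) (f : Iplus R ell -> X) : Prop :=
  forall (tau : circle K) (z z' : Iplus R ell),
    val z' = ((phi_ (val z) + tau, theta_ (val z)), (val z).2) -> f z' = f z.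

End impact_map.

(* For bijective [f], ['pinv_id setT f] is the inverse of [f]; the default
   [id] is never used in that case. *)
Definition iterz (X : Type) (f : X -> X) (i : int) : X -> X :=
  match i with
  | Posz n => iter n f
  | Negz n => iter n.+1 ('pinv_id setT f)
  end.

(* Main.v *)
Require Import Defs.
From mathcomp Require Import all_boot all_order all_algebra.
From mathcomp Require Import all_classical all_reals all_analysis.
From mathcomp Require Import zify ring lra.

Set Implicit Arguments.
Unset Strict Implicit.
Unset Printing Implicit Defensive.

Import Order.TTheory GRing.Theory Num.Theory.
Import numFieldNormedType.Exports.
Local Open Scope classical_set_scope.
Local Open Scope ring_scope.

(** Identify the plane with the complex numbers and let q be the boundary point
    hit by the knife-edge and c the center of the circle along which its
    midpoint moves.  The knife-edge leaves the disk at the reflection of q in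
    the line through 0 and c, so the angle Omega satisfies
    exp(i Omega) = (c / q)^2 / |c / q|^2.  The arccosine in its definition is the
    unsigned angle between q and c, and the sign of omega supplies the
    orientation, because the motion starts into the disk ([alpha_trig]).

    Multiplying c by omega removes the singularity at omega = 0, where c is at
    infinity; omega c then stands for v times the unit normal of the knife-edge.
    In the frame
    given by q / R and its rotation by a right angle, omega c has the
    coordinates X = [radial] and N = [nvel], the normal velocity.  Both are
    continuous in (theta, omega, v), they do not depend on phi, they do not
    vanish together ([sqr_center_gt0]), and Omega is twice the argument of
    X + i N ([Omega_trig]), also when omega = 0.  Hence Omega and Omega o T are
    rotation-invariant and continuous, the circle being embedded in the plane by
    its cosine and sine ([continuous_to_circle]).

    The free motion changes neither omega nor v, and it replaces theta by
    pi - theta, so that front and back are exchanged.  The reflection of the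
    velocities at the second impact is then the same linear involution as at
    the first one: T^2 gives back theta, omega and v, and only rotates phi by
    the drift ([TT_rot]).  As the drift is itself rotation-invariant, rotations
    by it add up along an orbit; this gives the inverse of T and all the
    iterates of T^2. *)

(** * The circle as a subset of the plane *)

Section circle.
Variable K : realType.
Implicit Types (x y : circle K) (a b : K).

Lemma ccosD x y : ccos (x + y) = ccos x * ccos y - csin x * csin y.
Proof.
have [a ->] := circ_repr x; have [b ->] := circ_repr y.
by rewrite -circD !ccosE !csinE cosD.
Qed.

Lemma csinD x y : csin (x + y) = csin x * ccos y + ccos x * csin y.
Proof.
have [a ->] := circ_repr x; have [b ->] := circ_repr y.
by rewrite -circD !ccosE !csinE sinD.
Qed.

(** Subtracting a multiple of 2 pi moves [a] to [-pi, pi], where the cosine of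
    the absolute value is injective. *)
Lemma cos_eq1_circ a : cos a = 1 -> circ a = circ 0.
Proof.
move=> ca1; have pi0 : 0 < pi *+ 2 :> K by rewrite pmulrn_lgt0 ?pi_gt0.
pose k := Num.floor ((a + pi) / (pi *+ 2)); pose b := a - pi *+ 2 *~ k.
have aE : circ b = circ a by apply/circE; exists (- k); rewrite mulrNz.
have cb1 : cos `|b| = 1 by rewrite cos_norm -ccosE aE ccosE.
have bpi : `|b| <= pi.
  have := floor_le ((a + pi) / (pi *+ 2)).
  have := floorD1_gt ((a + pi) / (pi *+ 2)).
  rewrite -/k ler_pdivlMr// ltr_pdivrMr// intrD mulrDl mul1r.
  rewrite !mulrzl ler_norml /b.
  set c := _ *~ k => h1 h2; rewrite mulr2n in h1.
  by apply/andP; split; lra.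
have : `|b| = 0.
  by apply: (@cos_inj K); rewrite ?in_itv/= ?cos0// ?lexx ?pi_ge0 ?normr_ge0.
by move/normr0_eq0 => b0; rewrite -aE b0.
Qed.

Lemma circle_eq x y : ccos x = ccos y -> csin x = csin y -> x = y.
Proof.
have [a ->] := circ_repr x; have [b ->] := circ_repr y.
rewrite !ccosE !csinE => hc hs.
have : circ (a - b) = circ 0.
  by apply: cos_eq1_circ; rewrite cosB hc hs -!expr2 cos2Dsin2.
by move=> ab; rewrite -[a in LHS](subrK b) circD ab -circD add0r.
Qed.

Lemma continuous_circ : continuous (@circ K).
Proof. exact: pi_continuous. Qed.

Lemma continuous_ccos : continuous (@ccos K).
Proof.
apply/quotient_continuous.
rewrite (_ : _ \o _ = cos); first exact: continuous_cos.
by apply/funext => a; exact: ccosE.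
Qed.

Lemma continuous_csin : continuous (@csin K).
Proof.
apply/quotient_continuous.
rewrite (_ : _ \o _ = sin); first exact: continuous_sin.
by apply/funext => a; exact: csinE.
Qed.

Lemma circ_asin a : 0 < cos a -> circ (asin (sin a)) = circ a.
Proof.
move=> ca; have sa : -1 <= sin a <= 1 by rewrite sin_geN1 sin_le1.
apply: circle_eq; rewrite ?ccosE ?csinE ?asinK ?in_itv//.
by rewrite cos_asin// -cos2sin2 sqrtr_sqr gtr0_norm.
Qed.

(** Near a point, the angle is recovered from its cosine and sine by the arcsine
    of the angular difference with the limit, which is continuous there. *)
Lemma continuous_to_circle (X : topologicalType) (f : X -> circle K) :
  continuous (@ccos K \o f) -> continuous (@csin K \o f) -> continuous f.
Proof.
move=> cf sf x; have [a fx] := circ_repr (f x).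
pose c (y : X) := ccos (f y) * cos a + csin (f y) * sin a.
pose s (y : X) := csin (f y) * cos a - ccos (f y) * sin a.
have cc : c @ x --> c x.
  apply: cvgD; apply: cvgM; try exact: cvg_cst.
    exact: cf.
  exact: sf.
have cs : s @ x --> s x.
  apply: cvgB; apply: cvgM; try exact: cvg_cst.
    exact: sf.
  exact: cf.
have c1 : c x = 1 by rewrite /c fx ccosE csinE -!expr2 cos2Dsin2.
have s0 : s x = 0 by rewrite /s fx ccosE csinE mulrC subrr.
have near_fE : {near x, (fun y : X => circ (a + asin (s y))) =1 f}.
  have : \forall y \near x, 0 < c y by apply: (cvgr_gt _ cc); rewrite c1.
  apply: filterS => y; rewrite /s /c; have [b ->] := circ_repr (f y).
  rewrite ccosE csinE -cosB -sinB => cb.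
  by rewrite circD circ_asin// -circD addrC subrK.
apply: cvg_trans (near_eq_cvg near_fE) _; rewrite /= -(nbhs_singleton near_fE).
apply: (@cvg_comp _ _ _ (fun y : X => a + asin (s y)) (@circ K)).
  apply: cvgD; first exact: cvg_cst.
  apply: (@cvg_comp _ _ _ s (@asin K)); first exact: cs.
  by apply: continuous_asin; rewrite s0 ltrN10 ltr01.
exact: continuous_circ.
Qed.

Lemma continuous_circleD (X : topologicalType) (f g : X -> circle K) :
  continuous f -> continuous g -> continuous (fun x : X => f x + g x).
Proof.
move=> cf cg.
have comp (h : circle K -> K) (k : X -> circle K) :
    continuous h -> continuous k -> continuous (fun x : X => h (k x)).
  by move=> ch ck x; apply: continuous_comp; [exact: ck|exact: ch].
have cc := continuous_ccos; have cs := continuous_csin.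
apply: continuous_to_circle.
  rewrite (_ : _ \o _ = fun x : X =>
      ccos (f x) * ccos (g x) - csin (f x) * csin (g x)).
    by move=> x; apply: cvgB; apply: cvgM; exact: comp.
  by apply/funext => x; exact: ccosD.
rewrite (_ : _ \o _ = fun x : X =>
    csin (f x) * ccos (g x) + ccos (f x) * csin (g x)).
  by move=> x; apply: cvgD; apply: cvgM; exact: comp.
by apply/funext => x; exact: csinD.
Qed.

End circle.

(** * The coupled circle map in velocity coordinates *)

Section kinematics.
Variables (K : realType) (R ell : {posnum K}).
Implicit Type z : state K.

(** This is 1 on front-type and -1 on back-type states.  Dividing by the
    absolute value makes its continuity on impact states immediate. *)
Definition side z : K := ccos (theta_ z) / `|ccos (theta_ z)|.

(** The normal velocity as a single formula for both types of impact; it is also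
    the tangential coordinate of omega c, relative to q. *)
Definition nvel z : K :=
  v_ z * ccos (theta_ z) + side z * ell%:num * omega_ z * csin (theta_ z).

(** The coordinate of omega c along q / R. *)
Definition radial z : K :=
  omega_ z * (R%:num - side z * ell%:num * ccos (theta_ z))
  + v_ z * csin (theta_ z).

Lemma side_front z : front R ell z -> side z = 1.
Proof.
move=> [_ hc]; have c0 : 0 < ccos (theta_ z) by apply: lt_trans hc.
by rewrite /side gtr0_norm// divff// gt_eqF.
Qed.

Lemma side_back z : back R ell z -> side z = -1.
Proof.
move=> [_ hc]; have c0 : 0 < - ccos (theta_ z) by apply: lt_trans hc.
rewrite oppr_gt0 in c0.
by rewrite /side ltr0_norm// invrN mulrN divff// lt_eqF.
Qed.

Lemma side_sq z : impact R ell z -> side z ^+ 2 = 1.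
Proof.
by case=> [/side_front|/side_back] ->; rewrite ?expr1n// sqrrN expr1n.
Qed.

Lemma impact_ccos_neq0 z : impact R ell z -> ccos (theta_ z) != 0.
Proof.
move=> /side_sq; apply: contra_eq_neq; rewrite /side => ->.
by rewrite mul0r expr0n eq_sym oner_eq0.
Qed.

Lemma side_flip z z' : theta_ z' = - theta_ z + circ pi -> side z' = - side z.
Proof. by rewrite /side => ->; rewrite ccos_flip normrN mulNr. Qed.

Lemma normal_velocityE z : impact R ell z -> normal_velocity R ell z = nvel z.
Proof.
rewrite /normal_velocity /nvel => -[fz|bz].
  by rewrite (front_in fz) (side_front fz); ring.
by rewrite (back_in bz) (side_back bz); ring.
Qed.

Lemma velocity_neq0 z : impact R ell z -> z.2 <> (0, 0).
Proof. by case=> -[]. Qed.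

Lemma midpointE z : impact R ell z ->
  midpoint R ell z =
  (R%:num * ccos (phi_ z) - side z * ell%:num * ccos (phi_ z - theta_ z),
   R%:num * csin (phi_ z) - side z * ell%:num * csin (phi_ z - theta_ z)).
Proof.
rewrite /midpoint => -[fz|bz].
  by rewrite (front_in fz) (side_front fz) mul1r.
by rewrite (back_in bz) (side_back bz) !mulN1r !mulNr !opprK.
Qed.

(** Both sides are the squared norm of omega c, on the right in the frame
    formed by the knife-edge and its normal. *)
Lemma sqr_center z : impact R ell z ->
  radial z ^+ 2 + nvel z ^+ 2
  = (omega_ z * (R%:num * ccos (theta_ z) - side z * ell%:num)) ^+ 2
    + (omega_ z * R%:num * csin (theta_ z) + v_ z) ^+ 2.
Proof.
move=> iz; have := side_sq iz; have := csc2 (theta_ z).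
rewrite /radial /nvel; set c := ccos _; set s := csin _; set sd := side z.
set w := omega_ z; set v := v_ z; set r := R%:num; set l := ell%:num.
move=> hcs hsd; have hs : s ^+ 2 = 1 - c ^+ 2 by rewrite -hcs addrK.
ring: hs hsd.
Qed.

(** The coordinate of c along the knife-edge, R cos theta -+ ell, is nonzero
    because ell / R < |cos theta|.  So omega c = 0 forces omega = 0, and
    then v = 0, which is excluded. *)
Lemma sqr_center_gt0 z : impact R ell z -> 0 < radial z ^+ 2 + nvel z ^+ 2.
Proof.
move=> iz; rewrite (sqr_center iz) lt_neqAle addr_ge0 ?sqr_ge0// andbT eq_sym.
rewrite paddr_eq0 ?sqr_ge0// !sqrf_eq0; apply/negP => /andP[].
have w0v0 := velocity_neq0 iz.
have AN0 : R%:num * ccos (theta_ z) - side z * ell%:num != 0.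
  have R0 : 0 < R%:num by [].
  have lR : ell%:num = ell%:num / R%:num * R%:num by rewrite divfK.
  case: iz => [fz|bz].
    rewrite (side_front fz) mul1r subr_eq0 gt_eqF// lR mulrC ltr_pM2l//.
    by case: fz.
  rewrite (side_back bz) mulN1r opprK addrC addr_eq0 -mulrN lt_eqF//.
  by rewrite lR mulrC ltr_pM2l//; case: bz.
rewrite mulf_eq0 (negbTE AN0) orbF => /eqP w0; rewrite w0 !mul0r add0r.
by move=> /eqP v0; apply: w0v0; rewrite [z.2]surjective_pairing w0 v0.
Qed.

Lemma center_distE z : impact R ell z -> omega_ z != 0 ->
  center_dist R ell z ^+ 2 = (radial z ^+ 2 + nvel z ^+ 2) / omega_ z ^+ 2.
Proof.
move=> iz w0; rewrite (sqr_center iz) sqr_sqrtr ?addr_ge0 ?sqr_ge0//.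
rewrite /Defs.center (midpointE iz) /=.
have [-> ->] : ccos z.1.1 = ccos (z.1.1 - z.1.2) * ccos z.1.2
      - csin (z.1.1 - z.1.2) * csin z.1.2
    /\ csin z.1.1 = csin (z.1.1 - z.1.2) * ccos z.1.2
      + ccos (z.1.1 - z.1.2) * csin z.1.2.
  by rewrite -ccosD -csinD subrK.
have := csc2 (z.1.1 - z.1.2); set C := ccos (_ - _); set S := csin (_ - _).
set c := ccos _; set s := csin _; set sd := side z.
set w := omega_ z in w0 *; set v := v_ z; set r := R%:num; set l := ell%:num.
move=> hCS; rewrite -[RHS]mulr1 -hCS.
by field.
Qed.

Lemma sqr_omega_dist z : impact R ell z -> omega_ z != 0 ->
  (omega_ z * center_dist R ell z) ^+ 2 = radial z ^+ 2 + nvel z ^+ 2.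
Proof.
by move=> iz w0; rewrite exprMn (center_distE iz w0) mulrC divfK ?expf_neq0.
Qed.

(** By the law of cosines, both sides are the cosine of the angle between q and
    c. *)
Lemma cos_alphaE z : impact R ell z -> omega_ z != 0 ->
  (center_dist R ell z ^+ 2 + R%:num ^+ 2 - path_radius ell z ^+ 2)
    / (2 * center_dist R ell z * R%:num)
  = radial z / (omega_ z * center_dist R ell z).
Proof.
move=> iz w0.
have d0 : center_dist R ell z != 0.
  rewrite -sqrf_eq0 center_distE// mulf_neq0 ?invr_neq0 ?expf_neq0//.
  by rewrite gt_eqF// sqr_center_gt0.
have R0 : R%:num != 0 by [].
have := side_sq iz; have := csc2 (theta_ z).
rewrite center_distE// sqr_sqrtr ?addr_ge0 ?sqr_ge0// sqr_center// /radial.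
move: d0; set d := center_dist _ _ _ => d0.
set c := ccos _; set s := csin _; set sd := side z.
set w := omega_ z in w0 *; set v := v_ z; set l := ell%:num.
move=> hcs hsd; have hs : s ^+ 2 = 1 - c ^+ 2 by rewrite -hcs addrK.
field: hs hsd; by rewrite d0 w0 R0.
Qed.

(** The arccosine only gives the unsigned angle between q and c.  On outgoing
    states N <= 0, so the cross product of q and c has the sign of -omega;
    multiplication by the sign of omega thus yields minus the signed angle. *)
Lemma alpha_trig z : impact R ell z -> nvel z <= 0 -> omega_ z != 0 ->
  let d := center_dist R ell z in
  cos (alpha R ell z) = radial z / (omega_ z * d)
  /\ Num.sg (omega_ z) * sin (alpha R ell z) = - (nvel z / (omega_ z * d)).
Proof.
move=> iz nz w0 d; rewrite /alpha (cos_alphaE iz w0) -/d.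
have X0 := sqr_center_gt0 iz.
have d2 := sqr_omega_dist iz w0; rewrite -/d in d2.
have d0 : 0 < d.
  rewrite lt_neqAle sqrtr_ge0 andbT eq_sym; apply: contraTneq X0 => d0.
  by rewrite -d2 d0 mulr0 expr0n ltxx.
set x := radial z / _; set y := nvel z / _.
have xy : x ^+ 2 + y ^+ 2 = 1.
  by rewrite /x /y !expr_div_n -mulrDl d2 divff// gt_eqF.
have x1 : -1 <= x <= 1.
  rewrite -ler_norml -(@expr_le1 _ 2)// real_normK ?num_real//.
  by rewrite -xy lerDl sqr_ge0.
split; first by rewrite acosK// in_itv.
rewrite sin_acos// (_ : 1 - x ^+ 2 = y ^+ 2); last by rewrite -xy addrC addKr.
rewrite sqrtr_sqr /y normrM normfV normrM (gtr0_norm d0) (ler0_norm nz).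
have [wn|wp|w00] := ltgtP (omega_ z) 0; last by rewrite w00 eqxx in w0.
- by rewrite ltr0_sg// ltr0_norm//; field; rewrite w0 gt_eqF.
- by rewrite gtr0_sg// gtr0_norm//; field; rewrite w0 gt_eqF.
Qed.

Lemma Iplus_impact (z : Iplus R ell) : impact R ell (val z).
Proof. by have /set_mem/IplusP[] := valP z. Qed.

(** For omega = 0, a tangential impact would have v cos theta = 0, hence
    v = 0. *)
Lemma RIv_plusE (z : Iplus R ell) :
  (val z \in RIv_plus R ell) = (omega_ (val z) == 0).
Proof.
have /set_mem Iz := valP z; apply/idP/eqP => [/set_mem[]//|w0].
apply/mem_set; split=> //; case: Iz => // -[iz /=].
rewrite (normal_velocityE iz) /nvel w0 mulr0 mul0r addr0 => /eqP.
rewrite mulf_eq0 (negbTE (impact_ccos_neq0 iz)) orbF => /eqP v0.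
by case: (velocity_neq0 iz); rewrite [LHS]surjective_pairing w0 v0.
Qed.

(** Omega is twice the argument of X + i N, in both branches of its definition:
    for omega = 0 one has X + i N = i v exp(- i theta), whose square has the
    argument pi - 2 theta. *)
Lemma Omega_trig (z : Iplus R ell) (u := val z) :
  ccos (Omega z) = (radial u ^+ 2 - nvel u ^+ 2) / (radial u ^+ 2 + nvel u ^+ 2)
  /\ csin (Omega z) = 2 * radial u * nvel u / (radial u ^+ 2 + nvel u ^+ 2).
Proof.
have /set_mem/IplusP[iz] := valP z; rewrite (normal_velocityE iz) => nz.
have X0 := sqr_center_gt0 iz; rewrite /Omega RIv_plusE.
have [w0|w0] := eqVneq.
- have -> : radial u = v_ u * csin (theta_ u) by rewrite /radial w0 mul0r add0r.
  have -> : nvel u = v_ u * ccos (theta_ u).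
    by rewrite /nvel w0 mulr0 mul0r addr0.
  have v0 : v_ u != 0.
    apply: contra_notN (velocity_neq0 iz) => /eqP v0.
    by rewrite [LHS]surjective_pairing w0 v0.
  rewrite mulr2n ccos_flip csin_flip ccosD csinD !exprMn -mulrDr csc2 mulr1.
  by split; field.
- have [ca sa] := alpha_trig iz nz w0.
  have sg2 : Num.sg (omega_ u) ^+ 2 = 1 by rewrite sqr_sg w0.
  have d2 := sqr_omega_dist iz w0.
  rewrite -d2 in X0 *; move: ca sa X0; rewrite -/u.
  set d := _ * center_dist _ _ _.
  set a := alpha _ _ _; set sg := Num.sg _ in sg2 * => ca sa.
  rewrite exprn_even_gt0//= => d0.
  have -> : -2 * sg * a = - (sg * a *+ 2) by rewrite -mulr_natl; ring.
  have [cE sE] : cos (sg * a) = cos a /\ sin (sg * a) = sg * sin a.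
    have /eqP := sg2; rewrite sqrf_eq1 => /orP[]/eqP ->; rewrite ?mul1r//.
    by rewrite !mulN1r cosN sinN.
  rewrite ccosE csinE cosN sinN cos_mulr2n sin_mulr2n cE sE sa ca; split.
    rewrite (_ : radial u ^+ 2 - _ = 2 * radial u ^+ 2 - d ^+ 2); first by field.
    by rewrite d2; ring.
  by field.
Qed.

Lemma Omega_ext (z z' : Iplus R ell) :
  theta_ (val z') = theta_ (val z) -> (val z').2 = (val z).2 ->
  Omega z' = Omega z.
Proof.
move=> th wv; have [c s] := Omega_trig z; have [c' s'] := Omega_trig z'.
by apply: circle_eq; rewrite ?c ?s ?c' ?s' /radial /nvel /side th wv.
Qed.

Section continuity.
Variables (X : topologicalType) (f : X -> Iplus R ell).
Hypotheses (cc : continuous (fun x => ccos (theta_ (val (f x)))))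
  (cs : continuous (fun x => csin (theta_ (val (f x)))))
  (cw : continuous (fun x => omega_ (val (f x))))
  (cv : continuous (fun x => v_ (val (f x)))).

Lemma continuous_side : continuous (fun x => side (val (f x))).
Proof.
move=> x; apply: cvgM; first exact: cc.
apply: cvgV; last by apply: cvg_norm; exact: cc.
by rewrite normr_eq0; exact/impact_ccos_neq0/Iplus_impact.
Qed.

Lemma continuous_nvel : continuous (fun x => nvel (val (f x))).
Proof.
move=> x; apply: cvgD; apply: cvgM; [exact: cv|exact: cc| |exact: cs].
apply: cvgM; last exact: cw.
by apply: cvgM; [exact: continuous_side|exact: cvg_cst].
Qed.

Lemma continuous_Omega : continuous (fun x => Omega (f x)).
Proof.
have cY := continuous_nvel.
have cX : continuous (fun x => radial (val (f x))).
  move=> x; apply: cvgD; apply: cvgM; [exact: cw| |exact: cv|exact: cs].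
  apply: cvgB; first exact: cvg_cst.
  apply: cvgM; last exact: cc.
  by apply: cvgM; [exact: continuous_side|exact: cvg_cst].
have cX2 : continuous (fun x => radial (val (f x)) ^+ 2).
  by move=> x; apply: cvgM; exact: cX.
have cY2 : continuous (fun x => nvel (val (f x)) ^+ 2).
  by move=> x; apply: cvgM; exact: cY.
have cD : continuous (fun x =>
    (radial (val (f x)) ^+ 2 + nvel (val (f x)) ^+ 2)^-1).
  move=> x; apply: cvgV.
    by rewrite gt_eqF// (sqr_center_gt0 (Iplus_impact _)).
  by apply: cvgD; [exact: cX2|exact: cY2].
apply: continuous_to_circle => x.
  rewrite (_ : _ \o _ = fun x =>
    (radial (val (f x)) ^+ 2 - nvel (val (f x)) ^+ 2)
    / (radial (val (f x)) ^+ 2 + nvel (val (f x)) ^+ 2)); last first.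
    by apply/funext => y; exact: (Omega_trig _).1.
  by apply: cvgM; [apply: cvgB; [exact: cX2|exact: cY2]|exact: cD].
rewrite (_ : _ \o _ = fun x => 2 * radial (val (f x)) * nvel (val (f x))
   / (radial (val (f x)) ^+ 2 + nvel (val (f x)) ^+ 2)); last first.
  by apply/funext => y; exact: (Omega_trig _).2.
apply: cvgM; last exact: cD.
apply: cvgM; last exact: cY.
by apply: cvgM; [exact: cvg_cst|exact: cX].
Qed.

End continuity.

End kinematics.

(** * Two impacts amount to a rotation *)

Section return_map.
Variables (K : realType) (R ell m J : {posnum K}).
Implicit Type z : Iplus R ell.
Local Notation T := (@T K R ell m J).

Lemma Dcoef_flip (th : circle K) :
  Dcoef ell m J (- th + circ pi) = Dcoef ell m J th.
Proof. by rewrite /Dcoef ccos_flip csin_flip sqrrN. Qed.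

(** The flip theta |-> pi - theta exchanges front and back and changes the sign
    of the cosine, so the reflection applied by T can be written in terms of the
    state before the motion, by one formula for both types. *)
Lemma valT z (u := val z) (D := Dcoef ell m J (theta_ u)) :
  val (T z) = ((phi_ u + Omega z, - theta_ u + circ pi),
    (omega_ u - 2 * nvel ell u * side u * ell%:num * csin (theta_ u)
                 / (J%:num * D),
     v_ u - 2 * nvel ell u * ccos (theta_ u) / (m%:num * D))).
Proof.
have D0 : D != 0 by rewrite gt_eqF// Dcoef_gt0.
rewrite /= /Imp_state /= -/u; case: (Iplus_impact z) => [fz|bz].
- have -> : (Ro_state z \in Iminus_f R ell) = false.
    apply/negP => /set_mem[_ fR]; exact: front_back fR (back_Ro fz).
  rewrite /= -/u [u.2]surjective_pairing refl_bE ccos_flip csin_flip Dcoef_flip.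
  rewrite -/D /nvel (side_front fz) -/u; congr (_, (_, _)).
    by field; rewrite D0 /=.
  by field; rewrite D0 /=.
- have -> : Ro_state z \in Iminus_f R ell.
    by apply/mem_set; split; [exact/set_mem/(valP (Ro z))|exact: front_Ro].
  rewrite /= -/u [u.2]surjective_pairing refl_fE ccos_flip csin_flip Dcoef_flip.
  rewrite -/D /nvel (side_back bz) -/u; congr (_, (_, _)).
    by field; rewrite D0 /=.
  by field; rewrite D0 /=.
Qed.

(** The impact reverses the normal velocity, and so does the free motion before
    it, which changes the signs of the side and of the cosine. *)
Lemma nvelT z : nvel ell (val (T z)) = nvel ell (val z).
Proof.
have := side_sq (Iplus_impact z); have := Dcoef_gt0 ell m J (theta_ (val z)).
rewrite {1}/nvel (@side_flip _ (val z) (val (T z))) ?valT//=.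
rewrite ccos_flip csin_flip.
set u := val z; set D := Dcoef _ _ _ _; set s := csin _; set c := ccos _.
move=> D0 sd2.
have DE : D = ell%:num ^+ 2 / J%:num * s ^+ 2 + (m%:num)^-1 * c ^+ 2 by [].
have J0 : J%:num != 0 by [].
have m0 : m%:num != 0 by [].
have D1 : D != 0 by rewrite gt_eqF.
set sd := side u in sd2 *; set N := nvel ell u.
have NE : N = v_ u * c + sd * ell%:num * omega_ u * s by [].
transitivity (- (v_ u * c + sd * ell%:num * omega_ u * s) + 2 * N
  * ((ell%:num ^+ 2 / J%:num * s ^+ 2 + (m%:num)^-1 * c ^+ 2) / D)).
  by field: sd2; rewrite D1 J0 m0.
by rewrite -NE -DE divff//; ring.
Qed.

(** At the second impact N is unchanged while the side and the cosine change
    sign, so the velocity increments of the first impact are undone. *)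
Lemma valTT z : val (T (T z)) =
  ((phi_ (val z) + drift m J z, theta_ (val z)), (val z).2).
Proof.
rewrite valT nvelT (@side_flip _ (val z) (val (T z))) ?valT//=.
rewrite ccos_flip csin_flip Dcoef_flip.
set u := val z; rewrite /drift addrA opprD opprK subrK.
rewrite [RHS]surjective_pairing /= [u.2]surjective_pairing.
by congr (_, (_, _)) => /=; ring.
Qed.

Lemma rot_subproof (tau : circle K) z :
  ((phi_ (val z) + tau, theta_ (val z)), (val z).2) \in Iplus R ell.
Proof.
set w : state K := (_, _); have /set_mem/IplusP[iz nz] := valP z.
have iw : impact R ell w by case: iz; [left|right].
by apply/mem_set/IplusP.
Qed.

Definition rot (tau : circle K) z : Iplus R ell :=
  exist (fun u => u \in Iplus R ell) _ (rot_subproof tau z).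

Lemma rot0 z : rot 0 z = z.
Proof. by apply: val_inj; rewrite /= addr0; case: (val z) => -[] []. Qed.

Lemma rotD tau tau' z : rot tau (rot tau' z) = rot (tau' + tau) z.
Proof. by apply: val_inj; rewrite /= addrA. Qed.

Lemma rotK (tau : circle K) : cancel (rot tau) (rot (- tau)).
Proof. by move=> z; rewrite rotD subrr rot0. Qed.

Lemma drift_SO2 : SO2_invariant (@drift K R ell m J).
Proof.
move=> tau z z' zz'; rewrite /drift; congr (_ + _).
  by apply: Omega_ext; rewrite zz'.
by apply: Omega_ext; rewrite !valT /nvel /side zz'.
Qed.

Lemma drift_rot tau z : drift m J (rot tau z) = drift m J z.
Proof. exact: (@drift_SO2 tau). Qed.

Lemma TT_rot z : T (T z) = rot (drift m J z) z.
Proof. by apply: val_inj; rewrite valTT. Qed.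

(** T^2 preserves the drift, so it is inverted by the rotation by minus the
    drift; composing this with T gives the inverse of T. *)
Lemma bijective_T : bijective T.
Proof.
have injT : injective T.
  move=> z z' zz'; have := congr1 T zz'; rewrite !TT_rot => rr.
  have dd : drift m J z = drift m J z'.
    by rewrite -(drift_rot (drift m J z) z) rr drift_rot.
  by apply: (can_inj (rotK (drift m J z))); rewrite rr dd.
have TK z : T (T (rot (- drift m J z) z)) = z.
  by rewrite TT_rot drift_rot rotD addNr rot0.
exists (fun z => T (rot (- drift m J z) z)) => z; last exact: TK.
by apply: injT; rewrite TK.
Qed.

Lemma iter_TT n z : iter (2 * n) T z = rot (drift m J z *+ n) z.
Proof.
elim: n => [|n IHn]; first by rewrite muln0 rot0.
by rewrite mulnS /= IHn TT_rot drift_rot rotD mulrSr.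
Qed.

Lemma iter_TTV (g : Iplus R ell -> Iplus R ell) : cancel g T ->
  forall n z, iter (2 * n) g z = rot (- (drift m J z *+ n)) z.
Proof.
move=> gK; have gg z : g (g z) = rot (- drift m J z) z.
  have := TT_rot (g (g z)); rewrite !gK => zE.
  by rewrite [in RHS]zE drift_rot rotK.
elim=> [|n IHn] z; first by rewrite muln0 mulr0n oppr0 rot0.
by rewrite mulnS /= IHn gg drift_rot rotD -opprD -mulrSr.
Qed.

Lemma iterz_T (i : int) z : iterz T (2 * i) z = rot (drift m J z *~ i) z.
Proof.
have gK : cancel ('pinv_id setT T) T.
  have [g _ Tg] := bijective_T; move=> y.
  by apply: (@pinvK _ _ id setT T); apply/mem_set; exists (g y).
case: i => n; first by rewrite -PoszM /iterz iter_TT.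
(* Negz n is -(n + 1), so twice it is Negz (2 n + 1), that is 2 (n + 1) inverse
   steps. *)
rewrite (_ : 2 * Negz n = Negz (2 * n).+1); last by rewrite !NegzE; lia.
by rewrite /iterz -[(2 * n).+2]/(2 + 2 * n)%N -mulnS (iter_TTV gK).
Qed.

(** The velocities after an impact are rational in the old ones, the side and the
    cosine and sine of theta, with the nonvanishing denominator D. *)
Lemma continuous_OmegaT (X : topologicalType) (f : X -> Iplus R ell) :
  continuous (fun x => ccos (theta_ (val (f x)))) ->
  continuous (fun x => csin (theta_ (val (f x)))) ->
  continuous (fun x => omega_ (val (f x))) ->
  continuous (fun x => v_ (val (f x))) ->
  continuous (fun x => Omega (T (f x))).
Proof.
move=> cc cs cw cv.
have cN := continuous_nvel cc cs cw cv.
have cside := continuous_side cc.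
have cD (a : {posnum K}) :
    continuous (fun x => (a%:num * Dcoef ell m J (theta_ (val (f x))))^-1).
  move=> x; apply: cvgV; first by rewrite gt_eqF// mulr_gt0// Dcoef_gt0.
  apply: cvgM; first exact: cvg_cst.
  apply: cvgD; apply: cvgM; try exact: cvg_cst.
    by apply: cvgM; exact: cs.
  by apply: cvgM; exact: cc.
have cN2 : continuous (fun x => 2 * nvel ell (val (f x))).
  by move=> x; apply: cvgM; [exact: cvg_cst|exact: cN].
have TfE x := valT (f x).
apply: continuous_Omega.
- under [X in continuous X]funext => x do rewrite TfE /= ccos_flip.
  by move=> x; apply: cvgN; exact: cc.
- under [X in continuous X]funext => x do rewrite TfE /= csin_flip.
  exact: cs.
- under [X in continuous X]funext => x do rewrite TfE /=.
  move=> x; apply: cvgB; first exact: cw.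
  apply: cvgM; last exact: cD.
  apply: cvgM; last exact: cs.
  apply: cvgM; last exact: cvg_cst.
  by apply: cvgM; [exact: cN2|exact: cside].
- under [X in continuous X]funext => x do rewrite TfE /=.
  move=> x; apply: cvgB; first exact: cv.
  apply: cvgM; last exact: cD.
  by apply: cvgM; [exact: cN2|exact: cc].
Qed.

Lemma continuous_drift : continuous (@drift K R ell m J).
Proof.
have cval : continuous (@set_val _ (Iplus R ell)) by exact: initial_continuous.
have cth : continuous (fun z => theta_ (val z)).
  move=> z.
  apply: (@continuous_comp _ _ _ (fun z : Iplus R ell => (val z).1) snd).
    apply: (@continuous_comp _ _ _ (@set_val _ (Iplus R ell)) fst).
      exact: cval.
    exact: cvg_fst.
  exact: cvg_snd.
have cw : continuous (fun z => omega_ (val z)).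
  move=> z.
  apply: (@continuous_comp _ _ _ (fun z : Iplus R ell => (val z).2) fst).
    apply: (@continuous_comp _ _ _ (@set_val _ (Iplus R ell)) snd).
      exact: cval.
    exact: cvg_snd.
  exact: cvg_fst.
have cv : continuous (fun z => v_ (val z)).
  move=> z.
  apply: (@continuous_comp _ _ _ (fun z : Iplus R ell => (val z).2) snd).
    apply: (@continuous_comp _ _ _ (@set_val _ (Iplus R ell)) snd).
      exact: cval.
    exact: cvg_snd.
  exact: cvg_snd.
have cc : continuous (fun z => ccos (theta_ (val z))).
  by move=> z; apply: continuous_comp; [exact: cth|exact: continuous_ccos].
have cs : continuous (fun z => csin (theta_ (val z))).
  by move=> z; apply: continuous_comp; [exact: cth|exact: continuous_csin].
have cO : continuous (fun z => Omega z) by exact: continuous_Omega.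
have cOT := continuous_OmegaT cc cs cw cv.
exact: continuous_circleD cO cOT.
Qed.

End return_map.

Theorem theorem3 (K : realType) (R ell m J : {posnum K}) :
  [/\ bijective (@T K R ell m J),
      continuous (@drift K R ell m J),
      SO2_invariant (@drift K R ell m J)
    & forall (i : int) (z : Iplus R ell),
        val (iterz (@T K R ell m J) (2 * i) z)
        = ((phi_ (val z) + drift m J z *~ i, theta_ (val z)),
           (omega_ (val z), v_ (val z)))].
Proof.
split; [exact: bijective_T|exact: continuous_drift|exact: drift_SO2|].
by move=> i z; rewrite iterz_T -surjective_pairing.
Qed.
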